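(* Let $f:R_{1}\rightarrow R_{2}$ be a homomorphism of commutative rings with identity, $J$ an ideal of $R_{2}$, $M_{1}$ an $R_{1}$-module, $M_{2}$ an $R_{2}$-module (regarded as an $R_1$-module via $f$) and $\varphi:M_{1}\rightarrow M_{2}$ an $R_{1}$-module homomorphism. Consider the $(R_{1}\Join^{f}J)$-module $M_{1}\Join^{\varphi}JM_{2}$, where $JM_{2}=\{0_{M_{2}}\}$, and let $N_1$ be a submodule of $M_1$. (1) If $J\subseteq\sqrt{0_{R_{2}}}$ and $N_{1}$ is a semi $n$-submodule of $M_{1}$, then $N_{1}\Join^{\varphi}JM_{2}$ is a semi $n$-submodule of $M_{1}\Join^{\varphi}JM_{2}$. (2) If $M_{2}$ is faithful and $N_{1}\Join^{\varphi}JM_{2}$ is a semi $n$-submodule of $M_{1}\Join^{\varphi}JM_{2}$, then $N_{1}$ is a semi $n$-submodule of $M_{1}$.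
   Context: Modules are unital; $M_2$ faithful means faithful as an $R_2$-module. $R_{1}\Join^{f}J=\{(r,f(r)+j): r\in R_1, j\in J\}$ is a subring of $R_1\times R_2$ (the amalgamation of $R_1$ and $R_2$ along $J$ with respect to $f$). $M_{1}\Join^{\varphi}JM_{2}=\{(m_1,\varphi(m_1)+m_2): m_1\in M_1, m_2\in JM_2\}$ is an $(R_1\Join^f J)$-module with scalar product $(r,f(r)+j)(m_1,\varphi(m_1)+m_2)=(rm_1,\varphi(rm_1)+f(r)m_2+j\varphi(m_1)+jm_2)$. For a submodule $N_1$ of $M_1$, $N_{1}\Join^{\varphi}JM_{2}=\{(m_1,\varphi(m_1)+m_2)\in M_1\Join^{\varphi}JM_2: m_1\in N_1\}$, a submodule of $M_{1}\Join^{\varphi}JM_{2}$. For a commutative ring $A$ with nilradical $\sqrt{0_A}$ and an $A$-module $X$, a proper submodule $Y$ of $X$ is called a semi $n$-submodule if whenever $a\in A$, $x\in X$ with $a^{2}x\in Y$, $a\notin\sqrt{0_A}$ and $Ann_A(x)=\{b\in A: bx=0\}=0$, then $ax\in Y$. *)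

(* Defs.v *)
(* Rings are [comPzRingType]s (commutative, with identity, possibly zero).
   A submodule is a [submodClosed] predicate and an ideal of [R] is a submodule
   of the regular module [R^o]; the improper ideal is allowed, unlike in
   [ring_quotient].  These predicates are bool-valued, which is no restriction
   here: [`[< P >]] of [boolp] turns any proposition [P] into a boolean. *)
From HB Require Import structures.
From mathcomp Require Import all_boot all_algebra.
From mathcomp Require Import boolp classical_sets.

Set Implicit Arguments.
Unset Strict Implicit.
Unset Printing Implicit Defensive.

Import GRing.Theory.

Local Open Scope ring_scope.
Local Open Scope classical_set_scope.

Definition nilradical (A : comPzRingType) : set A :=
  [set a | exists n : nat, a ^+ n = 0].
Arguments nilradical : clear implicits.

Definition annihilator (A : comPzRingType) (X : lmodType A) (x : X) : set A :=
  [set b | b *: x = 0].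

Definition faithful_module (A : comPzRingType) (X : lmodType A) : Prop :=
  [set b : A | forall x : X, b *: x = 0] = [set 0].

Definition ideal_smul (A : comPzRingType) (J : submodClosed A^o)
    (X : lmodType A) : set X :=
  [set x | exists2 s : seq (A * X),
     all (fun p => p.1 \in J) s & x = \sum_(p <- s) p.1 *: p.2].
Arguments ideal_smul {A} J X _.

Definition semi_n_submodule (A : comPzRingType) (X : lmodType A)
    (Y : submodClosed X) : Prop :=
  (exists x : X, x \notin Y) /\
  (forall (a : A) (x : X), a ^+ 2 *: x \in Y -> a \notin nilradical A ->
     annihilator x = [set 0] -> a *: x \in Y).

Section IdealSmul.
Variables (A : comPzRingType) (J : submodClosed A^o) (X : lmodType A).

Lemma ideal_smul0 : ideal_smul J X 0.
Proof. by exists [::] => //; rewrite big_nil. Qed.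

Lemma ideal_smulD (x y : X) :
  ideal_smul J _ x -> ideal_smul J _ y -> ideal_smul J _ (x + y).
Proof.
move=> [s sJ ->] [t tJ ->]; exists (s ++ t); first by rewrite all_cat sJ.
by rewrite big_cat.
Qed.

Lemma ideal_smulZ (a : A) (x : X) : ideal_smul J _ x -> ideal_smul J _ (a *: x).
Proof.
move=> [s sJ ->]; exists [seq (a * p.1, p.2) | p <- s].
  rewrite all_map; apply/allP => p ps /=.
  have pJ : (p.1 : A^o) \in J by have := allP sJ p ps.
  exact: (@rpredZ _ _ J a (p.1 : A^o) pJ).
by rewrite big_map scaler_sumr; apply: eq_bigr => p _; rewrite scalerA.
Qed.

Lemma ideal_smulM (j : A) (x : X) : j \in J -> ideal_smul J _ (j *: x).
Proof. by move=> jJ; exists [:: (j, x)]; rewrite /= ?jJ // big_seq1. Qed.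

End IdealSmul.

Section AmalgamatedRing.
Variables (R1 R2 : comPzRingType) (f : {rmorphism R1 -> R2}).
Variable J : submodClosed R2^o.

Definition amalg_ring_pred : {pred R1 * R2} :=
  fun x => `[< exists r, exists2 j, j \in J & x = (r, f r + j) >].

Lemma amalg_ring_predE x : (x \in amalg_ring_pred) = (x.2 - f x.1 \in J).
Proof.
apply/asboolP/idP => [[r [j jJ ->]] /=|xJ]; first by rewrite addrC addKr.
by exists x.1, (x.2 - f x.1) => //; rewrite addrC subrK -surjective_pairing.
Qed.

Lemma amalg_ring_subring : subring_closed amalg_ring_pred.
Proof.
have JZ (a b : R2) : b \in J -> a * b \in J by exact: (@rpredZ _ _ J a b).
have JD (a b : R2) : a \in J -> b \in J -> a + b \in J by exact: (@rpredD _ J).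
split=> [|_ _ /asboolP[r [j jJ ->]] /asboolP[s [k kJ ->]]
         |_ _ /asboolP[r [j jJ ->]] /asboolP[s [k kJ ->]]]; apply/asboolP.
- by exists 1, 0; rewrite ?rpred0 // rmorph1 addr0.
- exists (r - s), (j - k); first by rewrite -mulN1r JD ?JZ.
  by rewrite rmorphB addrACA -opprD.
- exists (r * s), (f r * k + f s * j + j * k); first by rewrite !JD ?JZ.
  congr (_, _); rewrite /= mulrDl !mulrDr rmorphM -!addrA.
  by congr (_ + (_ + _)); rewrite [f s * j]mulrC.
Qed.

Record amalg_ring :=
  AmalgRing { amalg_ring_val : R1 * R2; _ : amalg_ring_val \in amalg_ring_pred }.

HB.instance Definition _ := [isSub for amalg_ring_val].
HB.instance Definition _ := [Choice of amalg_ring by <:].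
HB.instance Definition _ :=
  GRing.SubChoice_isSubComPzRing.Build (R1 * R2)%type amalg_ring_pred amalg_ring
    amalg_ring_subring.

End AmalgamatedRing.

Section AmalgamatedModule.
Variables (R1 R2 : comPzRingType) (f : {rmorphism R1 -> R2}).
Variable J : submodClosed R2^o.
Variables (M1 : lmodType R1) (M2 : lmodType R2).
Variable phi : {linear M1 -> M2 | f \; *:%R}.

Definition amalg_mod_pred : {pred M1 * M2} :=
  fun x => `[< exists m1, exists2 m2, ideal_smul J M2 m2 & x = (m1, phi m1 + m2) >].

Lemma amalg_mod_zmod : zmod_closed amalg_mod_pred.
Proof.
split=> [|_ _ /asboolP[m [u uJ ->]] /asboolP[n [v vJ ->]]]; apply/asboolP.
  by exists 0, 0; [exact: ideal_smul0 | rewrite raddf0 addr0].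
exists (m - n), (u - v); last by rewrite raddfB addrACA -opprD.
by apply: ideal_smulD => //; rewrite -scaleN1r; apply: ideal_smulZ.
Qed.

Record amalg_mod :=
  AmalgMod { amalg_mod_val : M1 * M2; _ : amalg_mod_val \in amalg_mod_pred }.

HB.instance Definition _ := [isSub for amalg_mod_val].
HB.instance Definition _ := [Choice of amalg_mod by <:].
HB.instance Definition _ :=
  GRing.SubChoice_isSubZmodule.Build (M1 * M2)%type amalg_mod_pred amalg_mod
    amalg_mod_zmod.

Lemma amalg_mod_scale_formula (r : R1) (j : R2) (m1 : M1) (m2 : M2) :
  (r *: m1, (f r + j) *: (phi m1 + m2)) =
  (r *: m1, phi (r *: m1) + (f r *: m2 + j *: phi m1 + j *: m2)).
Proof. by rewrite linearZ /= scalerDr !scalerDl -!addrA [j *: _ + (_ + _)]addrCA. Qed.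

Fact amalg_mod_scale_subproof (a : amalg_ring f J) (x : amalg_mod) :
  ((val a).1 *: (val x).1, (val a).2 *: (val x).2) \in amalg_mod_pred.
Proof.
case: a x => _ /= /[dup] /asboolP[r [j jJ ->]] _.
case=> _ /= /[dup] /asboolP[m1 [m2 m2J ->]] _.
rewrite amalg_mod_scale_formula; apply/asboolP.
exists (r *: m1), (f r *: m2 + j *: phi m1 + j *: m2) => //.
by apply: ideal_smulD; [apply: ideal_smulD|];
  [exact: ideal_smulZ | exact: ideal_smulM | exact: ideal_smulZ].
Qed.

(* On representatives (r, f r + j) and (m1, phi m1 + m2) this is the usual
   scalar product, by [amalg_mod_scale_formula]. *)
Definition amalg_mod_scale (a : amalg_ring f J) (x : amalg_mod) : amalg_mod :=
  AmalgMod (amalg_mod_scale_subproof a x).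

Fact amalg_mod_scalerA (a b : amalg_ring f J) (x : amalg_mod) :
  amalg_mod_scale a (amalg_mod_scale b x) = amalg_mod_scale (a * b) x.
Proof. by apply: val_inj; rewrite /= !scalerA. Qed.

Fact amalg_mod_scale1r : left_id 1 amalg_mod_scale.
Proof.
by move=> x; apply: val_inj; rewrite /= !scale1r -surjective_pairing.
Qed.

Fact amalg_mod_scalerDr : right_distributive amalg_mod_scale +%R.
Proof. by move=> a x y; apply: val_inj; rewrite /= !scalerDr. Qed.

Fact amalg_mod_scalerDl (x : amalg_mod) :
  {morph amalg_mod_scale^~ x : a b / a + b}.
Proof. by move=> a b; apply: val_inj; rewrite /= !scalerDl. Qed.

HB.instance Definition _ :=
  GRing.Zmodule_isLmodule.Build (amalg_ring f J) amalg_mod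
    amalg_mod_scalerA amalg_mod_scale1r amalg_mod_scalerDr amalg_mod_scalerDl.

Definition amalg_submod (N1 : submodClosed M1) : {pred amalg_mod} :=
  fun x => (val x).1 \in N1.

Lemma amalg_submod_closed (N1 : submodClosed M1) :
  subsemimod_closed (amalg_submod N1).
Proof.
split; last by move=> a x; exact: (@rpredZ _ _ N1).
by split; [exact: (@rpred0 _ N1) | move=> x y; exact: (@rpredD _ N1)].
Qed.

HB.instance Definition _ (N1 : submodClosed M1) :=
  GRing.isSubmodClosed.Build (amalg_ring f J) amalg_mod (amalg_submod N1)
    (amalg_submod_closed N1).

End AmalgamatedModule.

Arguments amalg_mod {R1 R2 f} J {M1 M2} phi.
Arguments amalg_submod {R1 R2 f} J {M1 M2} phi N1.

(* Main.v *)
(* As J M2 = 0, every element of the amalgamated module is (m, phi m), and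
   (r, f r + j) sends it to (r m, phi (r m)); only first components matter.
   For (1), if r ^ n = 0 then (r, f r + j) ^ n = (0, j') with j' in J, which is
   nilpotent.  For (2), faithfulness of M2 forces J = 0. *)
Require Import Defs.
From HB Require Import structures.
From mathcomp Require Import all_boot all_algebra.
From mathcomp Require Import boolp classical_sets.

Import GRing.Theory.

Local Open Scope ring_scope.
Local Open Scope classical_set_scope.

Lemma annihilator_eq0P (A : comPzRingType) (X : lmodType A) (x : X) :
  annihilator x = [set 0] <-> (forall b : A, b *: x = 0 -> b = 0).
Proof.
split=> [x0 b bx|x0]; first by have : annihilator x b by []; rewrite x0.
by apply/seteqP; split=> b /=; [exact: x0 | move=> ->; rewrite /annihilator /= scale0r].
Qed.

(** Each [j *: x] is one of the generators of the submodule [J X], which is zero, so [j] annihilates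
    all of [X]. *)
Lemma faithful_ideal_smul_eq0 (A : comPzRingType) (J : submodClosed A^o)
    (X : lmodType A) (j : A) :
  faithful_module X -> ideal_smul J X = [set 0] -> j \in J -> j = 0.
Proof.
move=> faithX JX0 jJ.
suff : [set b : A | forall x : X, b *: x = 0] j by rewrite faithX.
by move=> x; have := ideal_smulM x jJ; rewrite JX0.
Qed.

Arguments faithful_ideal_smul_eq0 {A J X j}.

Section Amalgamation.
Set Implicit Arguments.
Unset Strict Implicit.
Variables (R1 R2 : comPzRingType) (f : {rmorphism R1 -> R2}).
Variable J : submodClosed R2^o.

Lemma amalg_ring_diag_proof (r : R1) : (r, f r) \in amalg_ring_pred f J.
Proof. by rewrite amalg_ring_predE /= subrr (@rpred0 _ J). Qed.

(** The lift of [r] with [j = 0], a section of the first projection; it carries scalars of [R1] into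
    the amalgamated ring. *)
Definition amalg_ring_diag (r : R1) : amalg_ring f J :=
  AmalgRing (amalg_ring_diag_proof r).

Lemma amalg_ring_valX (a : amalg_ring f J) n :
  val (a ^+ n) = ((val a).1 ^+ n, (val a).2 ^+ n).
Proof.
elim: n => [|n IHn]; first by rewrite !expr0.
by rewrite !exprS /= [amalg_ring_val (a ^+ n)]IHn.
Qed.

Lemma amalg_ring_fst_nilpotent (a : amalg_ring f J) :
  {subset J <= nilradical R2} -> nilradical R1 (val a).1 ->
  nilradical (amalg_ring f J) a.
Proof.
move=> Jnil [n rn0].
have : (val (a ^+ n)).2 \in J.
  have := valP (a ^+ n).
  by rewrite amalg_ring_predE amalg_ring_valX /= rn0 rmorph0 subr0.
move=> /Jnil; rewrite inE => -[k jk0].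
(* The successor keeps the outer exponent positive: [k] may be 0 when [R2] is the zero ring, and the
   first component [0 ^+ k.+1] must still vanish. *)
exists (n * k.+1)%N; apply: val_inj; rewrite exprM amalg_ring_valX.
by rewrite [(val _).2 ^+ _]exprS jk0 mulr0 amalg_ring_valX /= rn0 expr0n.
Qed.

Variables (M1 : lmodType R1) (M2 : lmodType R2).
Variable phi : {linear M1 -> M2 | f \; *:%R}.

Lemma amalg_mod_diag_proof (m : M1) : (m, phi m) \in amalg_mod_pred J phi.
Proof.
by apply/asboolP; exists m, 0; [exact: ideal_smul0 | rewrite addr0].
Qed.

Definition amalg_mod_diag (m : M1) : amalg_mod J phi :=
  AmalgMod (amalg_mod_diag_proof m).

Hypothesis JM2_0 : ideal_smul J M2 = [set 0].

Lemma amalg_mod_val2 (x : amalg_mod J phi) : (val x).2 = phi (val x).1.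
Proof.
by case: x => _ /= /asboolP[m [u uJ ->]]; move: uJ; rewrite JM2_0 => ->; rewrite /= addr0.
Qed.

Lemma amalg_mod_eq0 (x : amalg_mod J phi) : (val x).1 = 0 -> x = 0.
Proof.
move=> x0; apply: val_inj.
by rewrite [LHS]surjective_pairing amalg_mod_val2 x0 raddf0.
Qed.

(** If [b] kills the first component of [x], then [amalg_ring_diag b] kills [x], since an element
    with zero first component is zero. *)
Lemma annihilator_amalg_fst (x : amalg_mod J phi) :
  annihilator x = [set 0] -> annihilator (val x).1 = [set 0].
Proof.
move=> /annihilator_eq0P x0; apply/annihilator_eq0P => b bx.
have /(congr1 (fun a => (val a).1)) // : amalg_ring_diag b = 0.
by apply/x0/amalg_mod_eq0.
Qed.

(** If [b] kills the lift of [m], its first component kills [m] and so is 0. The second component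
    then lies in [J], which is zero by faithfulness. *)
Lemma annihilator_amalg_diag (m : M1) :
  faithful_module M2 -> annihilator m = [set 0] ->
  annihilator (amalg_mod_diag m) = [set 0].
Proof.
move=> faithM2 /annihilator_eq0P m0; apply/annihilator_eq0P => b bm.
have b0 : (val b).1 = 0 by apply: m0; move/(congr1 (fun x => (val x).1)): bm.
have b0' : (val b).2 = 0.
  apply: (faithful_ideal_smul_eq0 faithM2 JM2_0).
  by have := valP b; rewrite amalg_ring_predE b0 rmorph0 subr0.
by apply: val_inj; rewrite [LHS]surjective_pairing b0 b0'.
Qed.

End Amalgamation.

Arguments amalg_ring_diag {R1 R2} f J r.
Arguments amalg_mod_diag {R1 R2 f} J {M1 M2} phi m.

Theorem theorem9 (R1 R2 : comPzRingType) (f : {rmorphism R1 -> R2})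
    (J : submodClosed R2^o) (M1 : lmodType R1) (M2 : lmodType R2)
    (phi : {linear M1 -> M2 | f \; *:%R})
    (JM2_0 : ideal_smul J M2 = [set 0]) (N1 : submodClosed M1) :
  ({subset J <= nilradical R2} ->
     semi_n_submodule N1 -> semi_n_submodule (amalg_submod J phi N1)) /\
  (faithful_module M2 ->
     semi_n_submodule (amalg_submod J phi N1) -> semi_n_submodule N1).
Proof.
split=> [Jnil [[m mN1] N1semi]|faithM2 [[x xN1] Nsemi]]; split.
- by exists (amalg_mod_diag J phi m).
- move=> a x a2x a_nil annx.
  (* Membership in [amalg_submod] converts to a statement about first components, where [a] acts as
     [(val a).1]. *)
  apply: N1semi; [exact: a2x | | exact: annihilator_amalg_fst].
  apply: contra a_nil; rewrite !inE; exact: amalg_ring_fst_nilpotent.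
- by exists (val x).1.
- move=> r m r2m r_nil annm.
  (* The product of the two lifts has first component [r *: m], so the conclusion for the lifts is
     the goal. *)
  apply: (Nsemi (amalg_ring_diag f J r) (amalg_mod_diag J phi m)).
  + exact: r2m.
  (* A vanishing power of the lift projects to a vanishing power of [r]. *)
  + apply: contra r_nil; rewrite !inE => -[n /(congr1 (fun a => (val a).1))].
    by rewrite amalg_ring_valX => rn0; exists n.
  + exact: annihilator_amalg_diag.
Qed.
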